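(* Let $A$ be as in the context. If $A$ is $\Delta$-normal for some regular triangulation $\Delta$ of $cone(A)$, then there exists a generic cost vector $c\in\mathbb Z^n$ such that $\Delta=\Delta_c$ and $IP_{A,c}$ is a Gomory family.
   Context: $A\in\mathbb Z^{d\times n}$ has rank $d$, columns $a_1,\dots,a_n$, $cone(A)$ pointed, $\{x\in\mathbb R^n_{\ge0}:Ax=0\}=\{0\}$, $\mathbb ZA=\mathbb Z^d$, $\mathbb NA=\{Au:u\in\mathbb N^n\}$. For $c\in\mathbb R^n$, $\Delta_c$ is the collection of $\sigma\subseteq\{1,\dots,n\}$ (identified with cones $cone(A_\sigma)$) for which some $y\in\mathbb R^d$ has $y\cdot a_j=c_j$ ($j\in\sigma$), $y\cdot a_j<c_j$ ($j\notin\sigma$). A triangulation $\Delta$ of $cone(A)$ (with cones spanned by columns of $A$) is regular if $\Delta=\Delta_{c'}$ for some $c'$. A cost vector $c$ is generic if $\Delta_c$ is a triangulation and every program $IP_{A,c}(b)=\min\{c\cdot x: Ax=b,\ x\in\mathbb N^n\}$, $b\in\mathbb NA$, has a unique optimal solution; $IP_{A,c}$ is the family of these programs. For a maximal face $\sigma$ of $\Delta_c$ let $\tilde c_{\bar\sigma}=c_{\bar\sigma}-c_\sigma A_\sigma^{-1}A_{\bar\sigma}$; the group relaxation $G^\sigma(b)$ is $\min\{\tilde c_{\bar\sigma}\cdot x_{\bar\sigma}: A_\sigma x_\sigma+A_{\bar\sigma}x_{\bar\sigma}=b,\ x_{\bar\sigma}\ge0,\ x\in\mathbb Z^n\}$,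 which solves $IP_{A,c}(b)$ if its optimal solution is non-negative. $IP_{A,c}$ is a Gomory family if for every $b\in\mathbb NA$ some maximal face $\sigma$ of $\Delta_c$ has $G^\sigma(b)$ solving $IP_{A,c}(b)$. $A$ is $\Delta$-normal for a triangulation $\Delta$ if for every maximal face $\sigma$ of $\Delta$, the columns of $A$ lying in $cone(A_\sigma)$ form a Hilbert basis of $cone(A_\sigma)$ (i.e. generate the semigroup $cone(A_\sigma)\cap\mathbb Z^d$). *)

(* Defs.v *)
From HB Require Import structures.
From mathcomp Require Import all_boot all_order all_algebra.
From mathcomp Require Import reals.
Unset Printing Implicit Defensive.
Import Order.TTheory GRing.Theory Num.Theory.
Local Open Scope ring_scope.

Definition AR (R : realType) (d n : nat) (A : 'M[int]_(d, n)) : 'M[R]_(d, n) :=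
  map_mx (fun z : int => z%:~R) A.
Arguments AR R {d n}.

Definition colR (R : realType) (d n : nat) (A : 'M[int]_(d, n)) (j : 'I_n)
  : 'cV[R]_d := col j (AR R A).
Arguments colR R {d n}.

Definition ydot (R : realType) (d n : nat) (A : 'M[int]_(d, n))
  (y : 'rV[R]_d) (j : 'I_n) : R := (y *m colR R A j) 0 0.
Arguments ydot R {d n}.

Definition inCone (R : realType) (d n : nat) (A : 'M[int]_(d, n))
  (S : {set 'I_n}) (z : 'cV[R]_d) : Prop :=
  exists lam : 'I_n -> R, (forall j, 0 <= lam j) /\
    z = \sum_(j in S) lam j *: colR R A j.
Arguments inCone R {d n}.

Definition coneA (R : realType) (d n : nat) (A : 'M[int]_(d, n)) (z : 'cV[R]_d)
  : Prop := inCone R A setT z.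
Arguments coneA R {d n}.

Definition subT (R : realType) (d n : nat) (A : 'M[int]_(d, n)) (S : {set 'I_n})
  : 'M[R]_(#|S|, d) := \matrix_(k < #|S|, i < d) ((A i (enum_val k))%:~R).
Arguments subT R {d n}.

Definition lin_indep (R : realType) (d n : nat) (A : 'M[int]_(d, n))
  (S : {set 'I_n}) : bool := row_free (subT R A S).
Arguments lin_indep R {d n}.

(* Delta is a triangulation of cone(A) with cones spanned by columns of A:
   the cones cone(A_sigma), sigma in Delta, form a simplicial fan with
   support cone(A). *)
Definition triangulation (R : realType) (d n : nat) (A : 'M[int]_(d, n))
  (D : {set 'I_n} -> Prop) : Prop :=
  [/\ (forall s t : {set 'I_n}, D s -> t \subset s -> D t),
      (forall s, D s -> lin_indep R A s),
      (forall z, coneA R A z <-> exists s, D s /\ inCone R A s z) &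
      (forall s t, D s -> D t -> forall z,
          (inCone R A s z /\ inCone R A t z) <-> inCone R A (s :&: t) z)].
Arguments triangulation R {d n}.

Definition Delta (R : realType) (d n : nat) (A : 'M[int]_(d, n)) (c : 'rV[R]_n)
  (s : {set 'I_n}) : Prop :=
  exists y : 'rV[R]_d, forall j,
    (j \in s -> ydot R A y j = c 0 j) /\ (j \notin s -> ydot R A y j < c 0 j).
Arguments Delta R {d n}.

Definition regular_triangulation (R : realType) (d n : nat) (A : 'M[int]_(d, n))
  (D : {set 'I_n} -> Prop) : Prop :=
  triangulation R A D /\ exists c' : 'rV[R]_n, forall s, D s <-> Delta R A c' s.
Arguments regular_triangulation R {d n}.

Definition maxface (n : nat) (D : {set 'I_n} -> Prop) (s : {set 'I_n}) : Prop :=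
  D s /\ forall t, D t -> s \subset t -> t = s.
Arguments maxface {n}.

Definition inNA (d n : nat) (A : 'M[int]_(d, n)) (b : 'cV[int]_d) : Prop :=
  exists u : 'cV[int]_n, (forall j, 0 <= u j 0) /\ b = A *m u.
Arguments inNA {d n}.

Definition cost (R : realType) (n : nat) (c : 'rV[R]_n) (x : 'cV[int]_n) : R :=
  \sum_j c 0 j * (x j 0)%:~R.
Arguments cost R {n}.

Definition IPfeas (d n : nat) (A : 'M[int]_(d, n)) (b : 'cV[int]_d)
  (x : 'cV[int]_n) : Prop := (forall j, 0 <= x j 0) /\ A *m x = b.
Arguments IPfeas {d n}.

Definition IPopt (R : realType) (d n : nat) (A : 'M[int]_(d, n)) (c : 'rV[R]_n)
  (b : 'cV[int]_d) (x : 'cV[int]_n) : Prop :=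
  IPfeas A b x /\ forall x', IPfeas A b x' -> cost R c x <= cost R c x'.
Arguments IPopt R {d n}.

Definition generic (R : realType) (d n : nat) (A : 'M[int]_(d, n)) (c : 'rV[R]_n)
  : Prop :=
  triangulation R A (Delta R A c) /\
  forall b, inNA A b -> exists! x, IPopt R A c b x.
Arguments generic R {d n}.

(* A_sigma as a square d x d matrix (columns ordered by enum sigma) and c_sigma;
   for maximal faces of a triangulation #|sigma| = d and conform_mx is a cast *)
Definition Asq (R : realType) (d n : nat) (A : 'M[int]_(d, n)) (s : {set 'I_n})
  : 'M[R]_d := conform_mx 0 (subT R A s)^T.
Arguments Asq R {d n}.

Definition csig (R : realType) (n d : nat) (c : 'rV[R]_n) (s : {set 'I_n})
  : 'rV[R]_d := conform_mx 0 (\row_(k < #|s|) c 0 (enum_val k)).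
Arguments csig R {n} d.

(* reduced cost  c~ = c - c_sigma A_sigma^{-1} A  (only the entries outside
   sigma are used) *)
Definition ctilde (R : realType) (d n : nat) (A : 'M[int]_(d, n)) (c : 'rV[R]_n)
  (s : {set 'I_n}) : 'rV[R]_n :=
  c - (csig R d c s *m invmx (Asq R A s)) *m AR R A.
Arguments ctilde R {d n}.

Definition GRfeas (d n : nat) (A : 'M[int]_(d, n)) (s : {set 'I_n})
  (b : 'cV[int]_d) (x : 'cV[int]_n) : Prop :=
  A *m x = b /\ forall j, j \notin s -> 0 <= x j 0.
Arguments GRfeas {d n}.

Definition GRobj (R : realType) (d n : nat) (A : 'M[int]_(d, n)) (c : 'rV[R]_n)
  (s : {set 'I_n}) (x : 'cV[int]_n) : R :=
  \sum_(j | j \notin s) ctilde R A c s 0 j * (x j 0)%:~R.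
Arguments GRobj R {d n}.

Definition GRopt (R : realType) (d n : nat) (A : 'M[int]_(d, n)) (c : 'rV[R]_n)
  (s : {set 'I_n}) (b : 'cV[int]_d) (x : 'cV[int]_n) : Prop :=
  GRfeas A s b x /\ forall x', GRfeas A s b x' -> GRobj R A c s x <= GRobj R A c s x'.
Arguments GRopt R {d n}.

Definition GRsolves (R : realType) (d n : nat) (A : 'M[int]_(d, n)) (c : 'rV[R]_n)
  (s : {set 'I_n}) (b : 'cV[int]_d) : Prop :=
  exists x, GRopt R A c s b x /\ forall j, 0 <= x j 0.
Arguments GRsolves R {d n}.

Definition Gomory (R : realType) (d n : nat) (A : 'M[int]_(d, n)) (c : 'rV[R]_n)
  : Prop :=
  forall b, inNA A b -> exists s, maxface (Delta R A c) s /\ GRsolves R A c s b.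
Arguments Gomory R {d n}.

Definition Delta_normal (R : realType) (d n : nat) (A : 'M[int]_(d, n))
  (D : {set 'I_n} -> Prop) : Prop :=
  forall s, maxface D s ->
  forall z : 'cV[int]_d, inCone R A s (map_mx (fun k : int => k%:~R) z) ->
    exists m : 'I_n -> nat,
      (forall j, (m j != 0)%N -> inCone R A s (colR R A j)) /\
      z = \sum_j (m j)%:Z *: col j A.
Arguments Delta_normal R {d n}.

(* Main.v *)
Require Import Defs.
From HB Require Import structures.
From mathcomp Require Import all_boot all_order all_algebra.
From mathcomp Require Import boolp reals.
From mathcomp Require Import ring lra zify.
Import Order.TTheory GRing.Theory Num.Theory.
Local Open Scope ring_scope.

(* Start from a real c' with Delta = Delta_{c'}. Replace the cost of each column
   that is not a ray by the value there of the piecewise linear interpolation of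
   c' on the rays, plus a small multiple of its height (the sum of its
   coordinates in a maximal cone containing it). Let b lie in the cone of a
   maximal face s. Dearly priced columns outside cone(A_s) are not used by
   optimal solutions of G^s(b); the other terms add up to the height of
   b - A_s x_s, which is a point with nonnegative coordinates congruent modulo 1
   to those of b. So the height is smallest when x_s is the integer part of the
   coordinates of b, and Delta-normality provides such a solution: optimal
   solutions of G^s(b) are nonnegative. These are strict inequalities, so they
   survive rounding a large multiple of the cost to integers. The rounding is
   done so that c_j = B^j modulo B^n: competing optimal solutions have entries
   less than B outside s, so they can be told apart by their costs. *)

(** * Common thresholds over finite types and base-[B] digits *)

Lemma finite_eventually {T : finType} (Q : T -> nat -> Prop) :
  (forall t, exists N0, forall N, (N0 <= N)%N -> Q t N) ->
  exists N0, forall N, (N0 <= N)%N -> forall t, Q t N.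
Proof.
move=> /fin_all_exists[f hf]; exists (\max_t f t) => N hN t.
by apply: hf; apply: leq_trans hN; apply: leq_bigmax.
Qed.

Lemma eventually_lt_mul {R : realType} (a b : R) : 0 < a ->
  exists N0, forall N, (N0 <= N)%N -> b < N%:R * a.
Proof.
move=> a0; exists (Num.bound `|b / a|).+1 => N hN.
rewrite -ltr_pdivrMr //; apply: le_lt_trans (ler_norm _) _.
by apply: lt_le_trans (archi_boundP (normr_ge0 _)) _; rewrite ler_nat ltnW.
Qed.

(** Modulo [B] only the lowest digit survives, and a multiple of [B] of absolute value below [B] is
    zero. Cancelling one factor [B] leaves the same claim for the other digits. *)
Lemma digits_eq0 (n B : nat) (D : 'I_n -> int) :
  (forall j, `|D j| < B%:Z) ->
  (B%:Z ^+ n %| \sum_(j < n) B%:Z ^+ j * D j)%Z -> forall j, D j = 0.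
Proof.
elim: n D => [|n IH] D hD hdiv; first by case.
have B0 : B%:Z != 0.
  by apply/eqP => B0; move: (hD ord0); rewrite B0 ltNge normr_ge0.
move: hdiv; rewrite big_ord_recl expr0 mul1r.
under eq_bigr => j _ do rewrite lift0 exprS -mulrA.
rewrite -mulr_sumr => hdiv.
have D0 : D ord0 = 0.
  have : (B%:Z %| D ord0)%Z.
    rewrite -[D ord0](addrK (B%:Z * \sum_(j < n) B%:Z ^+ j * D (lift ord0 j))).
    rewrite rpredB ?dvdz_mulr //.
    by apply: dvdz_trans hdiv; rewrite exprS dvdz_mulr.
  move=> /dvdzP[q hq]; move: (hD ord0); rewrite hq normrM.
  case: (eqVneq q 0) => [-> |q0]; first by rewrite mul0r.
  rewrite ltNge -subr_le0; case/negP.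
  rewrite subr_le0 -[leLHS]mul1r ler_pM //.
  by rewrite -gtz0_ge1 normr_gt0.
move: hdiv; rewrite D0 add0r exprS dvdz_mul2l // => hdiv j.
case: (unliftP ord0 j) => [k ->|-> //].
by apply: (IH (fun k => D (lift ord0 k))).
Qed.

(** * Coordinates in the maximal simplicial cones *)

Definition selmx (R : realType) (d : nat) {n : nat} (s : {set 'I_n}) : 'M[R]_(n, d) :=
  conform_mx 0 (\matrix_(i < n, k < #|s|) (i == enum_val k)%:R).

(** The inverse of the square matrix of [s], padded with zero rows outside [s]. Indexing
    coefficients by ['I_n] makes coordinates in different faces comparable. *)
Definition coordmx (R : realType) {d n : nat} (A : 'M[int]_(d, n)) (s : {set 'I_n})
  : 'M[R]_(n, d) := selmx R d s *m invmx (Asq R A s).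

Lemma colRE {R : realType} {d n : nat} (A : 'M[int]_(d, n)) j :
  colR R A j = AR R A *m delta_mx j 0.
Proof. by rewrite /colR colE. Qed.

Lemma coordmx_spec {R : realType} {d n : nat} (A : 'M[int]_(d, n)) (s : {set 'I_n}) :
  #|s| = d -> lin_indep R A s ->
  [/\ AR R A *m coordmx R A s = 1%:M,
      forall j, j \notin s -> row j (coordmx R A s) = 0,
      forall j, j \in s -> coordmx R A s *m colR R A j = delta_mx j 0 &
      forall c, ctilde R A c s = c - c *m coordmx R A s *m AR R A].
Proof.
move=> e; case: _ / e A => A hs.
rewrite /ctilde /coordmx /Asq /csig /selmx !conform_mx_id.
set Q := \matrix_(_ < n, _ < _) _.
have AQ : AR R A *m Q = (subT R A s)^T.
  apply/matrixP => i k; rewrite !mxE (bigD1 (enum_val k)) //= !mxE eqxx mulr1.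
  rewrite big1 ?addr0 // => j /negPf jk; by rewrite !mxE jk mulr0.
have unit : (subT R A s)^T \in unitmx by rewrite unitmx_tr -row_free_unit.
split=> [|j js|j js|c].
- by rewrite mulmxA AQ mulmxV.
- rewrite row_mul [row j Q](_ : _ = 0) ?mul0mx //; apply/rowP => k; rewrite !mxE.
  by case: eqP => // jk; move: js; rewrite jk enum_valP.
- rewrite colRE.
  have -> : delta_mx j 0 = Q *m delta_mx (enum_rank_in js j) (0 : 'I_1).
    by apply/colP => i; rewrite -colE !mxE eqxx andbT enum_rankK_in.
  by rewrite -!mulmxA (mulmxA (AR R A)) AQ (mulmxA (invmx _)) mulVmx // mul1mx.
- congr (_ - _ *m _); rewrite conform_mx_id mulmxA; congr (_ *m _).
  apply/rowP => k; rewrite !mxE (bigD1 (enum_val k)) //= !mxE eqxx mulr1.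
  by rewrite big1 ?addr0 // => j /negPf jk; rewrite !mxE jk mulr0.
Qed.

Lemma ydotE {R : realType} {d n : nat} (A : 'M[int]_(d, n)) (y : 'rV[R]_d) j :
  ydot R A y j = (y *m AR R A) 0 j.
Proof. by rewrite /ydot /colR colE mulmxA -colE mxE. Qed.

Lemma cV_sum_delta {R : realType} {n : nat} (x : 'cV[R]_n) :
  x = \sum_j x j 0 *: delta_mx j 0.
Proof.
by rewrite {1}(matrix_sum_delta x); apply: eq_bigr => j _; rewrite big_ord1.
Qed.

Lemma AR_mul_sum {R : realType} {d n : nat} (A : 'M[int]_(d, n)) (x : 'cV[R]_n) :
  AR R A *m x = \sum_j x j 0 *: colR R A j.
Proof.
rewrite {1}(cV_sum_delta x) mulmx_sumr; apply: eq_bigr => j _.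
by rewrite -scalemxAr colRE.
Qed.

Lemma inConeP {R : realType} {d n : nat} (A : 'M[int]_(d, n)) (s : {set 'I_n}) z :
  inCone R A s z <-> exists x : 'cV[R]_n,
    [/\ forall j, 0 <= x j 0, forall j, j \notin s -> x j 0 = 0 & z = AR R A *m x].
Proof.
split=> [[lam [lam0 ->]]|[x [x0 xs ->]]].
- exists (\col_j (if j \in s then lam j else 0)); split=> [j|j /negPf js|].
  + by rewrite mxE; case: ifP.
  + by rewrite mxE js.
  + rewrite AR_mul_sum big_mkcond; apply: eq_bigr => j _; rewrite mxE.
    by case: ifP; rewrite ?scale0r.
- exists (x^~ 0); split=> //; rewrite AR_mul_sum [RHS]big_mkcond.
  apply: eq_bigr => j _.
  by case: ifPn => // /xs ->; rewrite scale0r.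
Qed.

Lemma inCone_subset {R : realType} {d n : nat} (A : 'M[int]_(d, n))
  (s t : {set 'I_n}) z : s \subset t -> inCone R A s z -> inCone R A t z.
Proof.
move=> st /inConeP[x [x0 xs ->]]; apply/inConeP; exists x; split=> // j jt.
by apply: xs; apply: contraNN jt; apply: (subsetP st).
Qed.

Lemma coord_supp {R : realType} {d n : nat} (A : 'M[int]_(d, n)) (s : {set 'I_n})
  m (z : 'M[R]_(d, m)) j k :
  #|s| = d -> lin_indep R A s -> j \notin s -> (coordmx R A s *m z) j k = 0.
Proof.
move=> sd si js; have [_ h _ _] := coordmx_spec A s sd si.
by have := congr1 (fun M => (M *m z) 0 k) (h j js); rewrite -row_mul mul0mx !mxE.
Qed.

Lemma coord_uniq {R : realType} {d n : nat} (A : 'M[int]_(d, n)) (s : {set 'I_n})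
  (x : 'cV[R]_n) : #|s| = d -> lin_indep R A s ->
  (forall j, j \notin s -> x j 0 = 0) -> coordmx R A s *m (AR R A *m x) = x.
Proof.
move=> sd si xs; have [_ _ h _] := coordmx_spec A s sd si.
rewrite AR_mul_sum mulmx_sumr [RHS]cV_sum_delta; apply: eq_bigr => j _.
rewrite -scalemxAr; case: (boolP (j \in s)) => [/h -> //|/xs ->].
by rewrite !scale0r.
Qed.

Lemma coordK {R : realType} {d n : nat} (A : 'M[int]_(d, n)) (s : {set 'I_n})
  m (z : 'M[R]_(d, m)) : #|s| = d -> lin_indep R A s ->
  AR R A *m (coordmx R A s *m z) = z.
Proof.
by move=> sd si; have [h _ _ _] := coordmx_spec A s sd si; rewrite mulmxA h mul1mx.
Qed.

Lemma inCone_coordP {R : realType} {d n : nat} (A : 'M[int]_(d, n))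
  (s : {set 'I_n}) (z : 'cV[R]_d) : #|s| = d -> lin_indep R A s ->
  inCone R A s z <-> forall i, 0 <= (coordmx R A s *m z) i 0.
Proof.
move=> sd si; split=> [/inConeP[x [x0 xs ->]] i|h].
  by rewrite coord_uniq.
apply/inConeP; exists (coordmx R A s *m z); split=> // [j js|].
  exact: coord_supp.
by rewrite coordK.
Qed.

(** The intersection axiom writes [z] on the columns of [s :&: t]; this expression is the unique one
    in both cones. *)
Lemma coord_eq {R : realType} {d n : nat} (A : 'M[int]_(d, n)) D
  (s t : {set 'I_n}) (z : 'cV[R]_d) : triangulation R A D ->
  D s -> D t -> #|s| = d -> #|t| = d -> inCone R A s z -> inCone R A t z ->
  coordmx R A s *m z = coordmx R A t *m z.
Proof.
move=> [_ Di _ DI] Ds Dt sd td zs zt.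
have /inConeP[x [_ xst ->]] : inCone R A (s :&: t) z by apply/(DI _ _ Ds Dt).
have xs j : j \notin s -> x j 0 = 0.
  by move=> js; apply: xst; rewrite inE (negPf js).
have xt j : j \notin t -> x j 0 = 0.
  by move=> jt; apply: xst; rewrite inE (negPf jt) andbF.
by rewrite !coord_uniq //; apply: Di.
Qed.

(** * Reduced costs and the faces of [Delta] *)

Lemma ctildeE {R : realType} {d n : nat} (A : 'M[int]_(d, n)) (s : {set 'I_n})
  (c : 'rV[R]_n) : #|s| = d -> lin_indep R A s ->
  ctilde R A c s = c - c *m coordmx R A s *m AR R A.
Proof. by move=> sd si; have [_ _ _ ->] := coordmx_spec A s sd si. Qed.

Lemma ctilde_in {R : realType} {d n : nat} (A : 'M[int]_(d, n)) (s : {set 'I_n})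
  (c : 'rV[R]_n) j : #|s| = d -> lin_indep R A s -> j \in s ->
  ctilde R A c s 0 j = 0.
Proof.
move=> sd si js; have [_ _ h _] := coordmx_spec A s sd si.
rewrite ctildeE // 2!mxE -[X in _ + - X]ydotE /ydot -mulmxA h // -colE mxE.
exact: subrr.
Qed.

(** The equalities on [s] force [y = c *m coordmx R A s], and [ctilde] is then the slack of the
    remaining inequalities. *)
Lemma DeltaP {R : realType} {d n : nat} (A : 'M[int]_(d, n)) (s : {set 'I_n})
  (c : 'rV[R]_n) : #|s| = d -> lin_indep R A s ->
  Delta R A c s <-> forall j, j \notin s -> 0 < ctilde R A c s 0 j.
Proof.
move=> sd si; split=> [[y hy] j js|h].
  have -> : ctilde R A c s 0 j = c 0 j - ydot R A y j.
    rewrite ctildeE // 2!mxE ydotE; congr (_ - (_ *m _) _ _).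
    have [AL hL _ _] := coordmx_spec A s sd si.
    rewrite -[RHS]mulmx1 -AL mulmxA; apply/rowP => k; rewrite [LHS]mxE [RHS]mxE.
    apply: eq_bigr => i _; case: (boolP (i \in s)) => [/(hy i).1|/hL].
      by rewrite ydotE => ->.
    by move=> /(congr1 (fun M : 'rV_d => M 0 k)); rewrite !mxE => ->; rewrite !mulr0.
  by rewrite subr_gt0; apply: (hy j).2.
exists (c *m coordmx R A s) => j; rewrite ydotE.
have e : ctilde R A c s 0 j = c 0 j - (c *m coordmx R A s *m AR R A) 0 j.
  by rewrite ctildeE // 2!mxE.
split=> js; last by rewrite -subr_gt0 -e h.
by apply/eqP; rewrite eq_sym -subr_eq0 -e ctilde_in.
Qed.

(** Subtract from the certificate a small multiple of the functional [v] that is 1 on [s] minus [t]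
    and 0 on [t]. The slack of the columns outside [s] absorbs a small enough change. *)
Lemma Delta_face {R : realType} {d n : nat} (A : 'M[int]_(d, n))
  (s t : {set 'I_n}) (c : 'rV[R]_n) : #|s| = d -> lin_indep R A s ->
  t \subset s -> Delta R A c s -> Delta R A c t.
Proof.
move=> sd si ts [y hy].
pose v : 'rV[R]_d := (\row_j (j \notin t)%:R) *m coordmx R A s.
have hv j : j \in s -> ydot R A v j = (j \notin t)%:R.
  move=> js; have [_ _ h _] := coordmx_spec A s sd si.
  by rewrite /ydot /v -mulmxA h // -colE !mxE.
have [N hN] : exists N0, forall N, (N0 <= N)%N -> forall j, j \notin s ->
    - ydot R A v j < N%:R * (c 0 j - ydot R A y j).
  apply: finite_eventually => j; case: (boolP (j \in s)) => js; first by exists 0%N.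
  have [N0 h] := eventually_lt_mul (c 0 j - ydot R A y j) (- ydot R A v j)
    (etrans (subr_gt0 _ _) ((hy j).2 js)).
  by exists N0 => N /h.
have {}hN := hN N.+1 (leqnSn N).
have N0 : 0 < N.+1%:R :> R by rewrite ltr0n.
exists (y - N.+1%:R^-1 *: v) => j.
have -> : ydot R A (y - N.+1%:R^-1 *: v) j = ydot R A y j - N.+1%:R^-1 * ydot R A v j.
  by rewrite !ydotE mulmxBl -scalemxAl !mxE.
split=> jt.
  have js := subsetP ts _ jt.
  by rewrite hv // jt mulr0 subr0; apply: (hy j).1.
case: (boolP (j \in s)) => js.
  by rewrite hv // jt (hy j).1 // mulr1 ltrBlDr ltrDl invr_gt0.
have := hN j js; rewrite -ltr_pdivrMl // mulrN; set q := _ * ydot R A v j; lra.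
Qed.

(** Ratio test of the simplex method: move [y] along a functional that vanishes on [s] and is
    positive on some column, and stop when the first new inequality becomes tight. *)
Lemma Delta_extend {R : realType} {d n : nat} (A : 'M[int]_(d, n))
  (s : {set 'I_n}) (c : 'rV[R]_n) : \rank (AR R A) = d -> (#|s| < d)%N ->
  Delta R A c s -> exists t : {set 'I_n}, [/\ s \proper t & Delta R A c t].
Proof.
move=> Ar sd [y hy].
have [u [u0 hu]] : exists v : 'rV[R]_d, v != 0 /\ forall j, j \in s -> ydot R A v j = 0.
  have : kermx (subT R A s)^T != 0.
    rewrite -mxrank_eq0 mxrank_ker mxrank_tr subn_eq0 -ltnNge.
    exact: leq_ltn_trans (rank_leq_row _) sd.
  move=> /rowV0Pn[v /sub_kermxP hv v0]; exists v; split=> // j js.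
  have := congr1 (fun M : 'rV_#|s| => M 0 (enum_rank_in js j)) hv.
  rewrite !mxE => h; rewrite -[RHS]h ydotE mxE; apply: eq_bigr => i _.
  by rewrite !mxE enum_rankK_in.
have [v [hv [j0 j0v]]] : exists v : 'rV[R]_d,
    (forall j, j \in s -> ydot R A v j = 0) /\ exists j, 0 < ydot R A v j.
  have /rV0Pn[j uj] : u *m AR R A != 0.
    by rewrite mulmx_free_eq0 // /row_free Ar.
  case: (ltP 0 (ydot R A u j)) => uj0; first by exists u; split=> //; exists j.
  exists (- u); split=> [i si|]; first by rewrite ydotE mulNmx mxE -ydotE hu ?oppr0.
  by exists j; rewrite ydotE mulNmx mxE -ydotE oppr_gt0 lt_neqAle uj0 andbT ydotE.
pose f j := (c 0 j - ydot R A y j) / ydot R A v j.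
case: (@arg_minP _ _ _ j0 (fun j => 0 < ydot R A v j) f j0v) => k vk kmin.
have ydotD j : ydot R A (y + f k *: v) j = ydot R A y j + f k * ydot R A v j.
  by rewrite !ydotE mulmxDl -scalemxAl !mxE.
have ydot_le j : ydot R A y j <= c 0 j.
  by case: (boolP (j \in s)) => [/(hy j).1 -> //|/(hy j).2 /ltW].
have fk0 : 0 <= f k by rewrite divr_ge0 ?subr_ge0 // ltW.
have le_c j : ydot R A (y + f k *: v) j <= c 0 j.
  rewrite ydotD -lerBrDl; case: (ltP 0 (ydot R A v j)) => vj.
    by rewrite -ler_pdivlMr //; apply: kmin.
  by apply: le_trans (_ : 0 <= _); rewrite ?subr_ge0 // mulr_ge0_le0.
exists [set j | ydot R A (y + f k *: v) j == c 0 j]; split.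
  apply/properP; split.
    apply/subsetP => j js; rewrite inE ydotD hv // mulr0 addr0.
    by rewrite (hy j).1.
  exists k; last by apply: contraTN vk => /hv ->; rewrite ltxx.
  by rewrite inE ydotD /f divfK ?(gt_eqF vk) // addrC subrK.
exists (y + f k *: v) => j; rewrite inE; split=> [/eqP //|jc].
by rewrite lt_neqAle jc le_c.
Qed.

Lemma Delta_full_face {R : realType} {d n : nat} (A : 'M[int]_(d, n))
  (s : {set 'I_n}) (c : 'rV[R]_n) : \rank (AR R A) = d ->
  (forall t, Delta R A c t -> lin_indep R A t) ->
  Delta R A c s -> exists t : {set 'I_n}, [/\ s \subset t, Delta R A c t & #|t| = d].
Proof.
move=> Ar Di; move: {2}(d - #|s|)%N (leqnn (d - #|s|)) => k.
elim: k s => [|k IH] s hk Ds.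
  exists s; split=> //; apply/eqP; rewrite eqn_leq -{1}(eqP (Di s Ds)) rank_leq_col.
  by rewrite -subn_eq0 -leqn0.
case: (ltnP #|s| d) => sd; last first.
  exists s; split=> //; apply/eqP; rewrite eqn_leq sd andbT.
  by rewrite -(eqP (Di s Ds)) rank_leq_col.
have [t [st Dt]] := Delta_extend A s c Ar sd Ds.
have [|u [tu Du ud]] := IH t _ Dt.
  have := proper_card st; lia.
by exists u; split=> //; apply: subset_trans tu; apply: proper_sub.
Qed.

Lemma full_maxface {R : realType} {d n : nat} (A : 'M[int]_(d, n))
  (D : {set 'I_n} -> Prop) s : (forall t, D t -> lin_indep R A t) ->
  D s -> #|s| = d -> maxface D s.
Proof.
move=> Di Ds sd; split=> // t Dt st; apply/esym/eqP.
by rewrite eqEcard st sd -(eqP (Di t Dt)) rank_leq_col.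
Qed.

(* Weak duality: the sum of the columns in [s] lies in the cone of some face
   [t] of [D]; comparing its values under the dual certificates of [s] and
   [t] forces [s \subset t]. *)
Lemma Delta_eq {R : realType} {d n : nat} (A : 'M[int]_(d, n))
  (D : {set 'I_n} -> Prop) (c : 'rV[R]_n) : triangulation R A D ->
  (forall s, D s -> Delta R A c s) -> forall s, D s <-> Delta R A c s.
Proof.
move=> [Dsub _ Dcov _] Dc s; split; first exact: Dc.
move=> [y hy].
have /Dcov[t [Dt /inConeP[x [x0 xt hx]]]] : coneA R A (\sum_(j in s) colR R A j).
  apply: (inCone_subset A s); first exact: subsetT.
  by exists (fun=> 1); split=> //; apply: eq_bigr => j _; rewrite scale1r.
have [y' hy'] := Dc t Dt.
have dots (u : 'rV_d) : \sum_(j in s) ydot R A u j = \sum_j x j 0 * ydot R A u j.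
  transitivity ((u *m \sum_(j in s) colR R A j) 0 0).
    by rewrite mulmx_sumr summxE.
  rewrite hx AR_mul_sum mulmx_sumr summxE; apply: eq_bigr => j _.
  by rewrite -scalemxAr mxE.
have le1 : \sum_(j in s) c 0 j <= \sum_(j in s) ydot R A y' j.
  have -> : \sum_(j in s) c 0 j = \sum_(j in s) ydot R A y j.
    by apply: eq_bigr => j /(hy j).1.
  rewrite !dots; apply: ler_sum => j _; case: (boolP (j \in t)) => jt.
    rewrite ler_wpM2l // (hy' j).1 //.
    by case: (boolP (j \in s)) => [/(hy j).1 -> //|/(hy j).2 /ltW].
  by rewrite xt // !mul0r.
have ydot_le j : ydot R A y' j <= c 0 j.
  by case: (boolP (j \in t)) => [/(hy' j).1 -> //|/(hy' j).2 /ltW].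
apply: (Dsub t) => //; apply/subsetP => j js; apply: contraLR le1 => jt.
rewrite -ltNge (bigD1 j) //= [ltRHS](bigD1 j) //=.
by apply: ltr_leD; [apply: (hy' j).2|apply: ler_sum].
Qed.

(** * Heights and the group relaxation *)

(** Since [ctilde] vanishes on [s], the sum may run over all columns. The correction depends on
    [A *m x] only, so on the solutions for a fixed [b] both objectives give the same order. *)
Lemma GRobj_cost {R : realType} {d n : nat} (A : 'M[int]_(d, n)) (s : {set 'I_n})
  (c : 'rV[R]_n) (x : 'cV[int]_n) : #|s| = d -> lin_indep R A s ->
  GRobj R A c s x =
  cost R c x - (c *m coordmx R A s *m map_mx (fun z : int => z%:~R) (A *m x)) 0 0.
Proof.
move=> sd si; rewrite /GRobj.
transitivity ((ctilde R A c s *m map_mx (fun z : int => z%:~R) x) 0 0).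
  rewrite mxE [RHS](bigID [in s]) /= [X in _ = X + _]big1 ?add0r; last first.
    by move=> j js; rewrite ctilde_in // mul0r.
  by apply: eq_bigr => j _; rewrite [map_mx _ _ _ _]mxE.
rewrite ctildeE // mulmxBl -mulmxA map_mxM [LHS]mxE [X in _ + X]mxE; congr (_ + _).
  by rewrite /cost mxE; apply: eq_bigr => j _; rewrite mxE.
by rewrite !mulmxA.
Qed.

Lemma coord_rep {R : realType} {d n : nat} (A : 'M[int]_(d, n)) (s : {set 'I_n})
  (x : 'cV[int]_n) i : #|s| = d -> lin_indep R A s ->
  (coordmx R A s *m map_mx (fun z : int => z%:~R) (A *m x)) i 0 =
  (if i \in s then (x i 0)%:~R else 0) +
  \sum_(j | j \notin s) (x j 0)%:~R * (coordmx R A s *m colR R A j) i 0.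
Proof.
move=> sd si; have [_ _ h _] := coordmx_spec A s sd si.
rewrite map_mxM -/(AR R A) AR_mul_sum mulmx_sumr summxE (bigID [in s]) /=.
congr (_ + _); last first.
  by apply: eq_bigr => j _; rewrite -scalemxAr mxE [in LHS]mxE.
transitivity (\sum_(j in s | j == i) (x j 0)%:~R : R).
  rewrite big_mkcondr; apply: eq_bigr => j js.
  rewrite -scalemxAr h // 3!mxE eqxx andbT eq_sym.
  by case: eqP => _; rewrite ?mulr1 ?mulr0.
case: ifP => si'; last by rewrite big1 // => j /andP[js /eqP ji]; rewrite -ji js in si'.
rewrite (big_pred1 i) // => j; apply/andP/eqP => [[_ /eqP]//|->].
by rewrite si' eqxx.
Qed.

(** For a maximal face [s], the linear functional with value 1 on every column of [s]. *)
Definition height (R : realType) {d n : nat} (A : 'M[int]_(d, n)) (s : {set 'I_n})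
  (z : 'cV[R]_d) : R := \sum_i (coordmx R A s *m z) i 0.

Lemma height_rep {R : realType} {d n : nat} (A : 'M[int]_(d, n)) (s : {set 'I_n})
  (x : 'cV[int]_n) : #|s| = d -> lin_indep R A s ->
  height R A s (map_mx (fun z : int => z%:~R) (A *m x)) =
  \sum_(i in s) (x i 0)%:~R +
  \sum_(j | j \notin s) (x j 0)%:~R * height R A s (colR R A j).
Proof.
move=> sd si; rewrite /height.
under eq_bigr do rewrite coord_rep //.
rewrite big_split /= -big_mkcond exchange_big; congr (_ + _).
by apply: eq_bigr => j _; rewrite mulr_sumr.
Qed.

(** Every point of the set [G] below is cheaper than every feasible point outside it, even though
    the reduced costs follow the heights only up to a relative error. [G] is finite and nonempty,
    its points are nonnegative, and [sep] excludes ties in it. *)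
Lemma group_relaxation_opt {R : realType} {d n : nat} (A : 'M[int]_(d, n))
  (s : {set 'I_n}) (c : 'rV[R]_n) (k : R) (B : nat) (b : 'cV[int]_d) :
  #|s| = d -> lin_indep R A s -> 0 < k -> (0 < B)%N ->
  (forall j, j \notin s -> inCone R A s (colR R A j) ->
     k * (1 - (2 * d + 2)%:R^-1) * height R A s (colR R A j) <= ctilde R A c s 0 j
       <= k * (1 + (2 * d + 2)%:R^-1) * height R A s (colR R A j)) ->
  (forall j, j \notin s -> inCone R A s (colR R A j) ->
     d%:R < B%:R * height R A s (colR R A j)) ->
  (forall j, j \notin s -> ~ inCone R A s (colR R A j) ->
     k * (2 * d + 2)%:R <= ctilde R A c s 0 j) ->
  (forall j, j \notin s -> 0 < ctilde R A c s 0 j) ->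
  (forall x x' : 'cV[int]_n, (forall i, i \in s -> x i 0 = x' i 0) ->
     (forall j, j \notin s -> 0 <= x j 0 < B%:Z) ->
     (forall j, j \notin s -> 0 <= x' j 0 < B%:Z) ->
     cost R c x = cost R c x' -> x = x') ->
  (forall z : 'cV[int]_d, inCone R A s (map_mx (fun k : int => k%:~R) z) ->
    exists m : 'I_n -> nat,
      (forall j, (m j != 0)%N -> inCone R A s (colR R A j)) /\
      z = \sum_j (m j)%:Z *: col j A) ->
  inCone R A s (map_mx (fun k : int => k%:~R) b) ->
  exists x : 'cV[int]_n, [/\ forall j, 0 <= x j 0, GRfeas A s b x &
    forall x', GRfeas A s b x' -> x' <> x -> GRobj R A c s x < GRobj R A c s x'].
Proof.
move=> sd si k0 B0 Hin HB Hout ct0 sep normal bs.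
set L := coordmx R A s; set h := height R A s in Hin HB *.
set rho : R := (2 * d + 2)%:R^-1 in Hin.
have [rho0 rhoE] : 0 < rho /\ rho * (2 * d%:R + 2) = 1.
  have dE : (2 * d + 2)%:R = 2 * d%:R + 2 :> R by rewrite natrD natrM.
  have d2 : 0 < 2 * d%:R + 2 :> R by have := ler0n R d; lra.
  by rewrite /rho dE invr_gt0 d2 mulVf ?gt_eqF.
set lam := L *m map_mx (fun z : int => z%:~R) b.
have lam0 i : 0 <= lam i 0 by apply: (inCone_coordP A s _ sd si).1.
pose fl i := Num.floor (lam i 0).
have fl0 i : 0 <= fl i by rewrite /fl floor_ge0.
(* The height left over once the integer parts are taken off [b]: a sum of [d] fractional parts, so
   between 0 and [d]. *)
pose S : R := h (map_mx (fun z : int => z%:~R) b) - \sum_(i in s) (fl i)%:~R.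
have S_E : S = \sum_(i in s) (lam i 0 - (fl i)%:~R).
  rewrite sumrB /S /h /height; congr (_ - _); rewrite [LHS](bigID [in s]) /=.
  by rewrite [X in _ + X]big1 ?addr0 // => i is'; rewrite coord_supp.
have Sge0 : 0 <= S.
  by rewrite S_E sumr_ge0 // => i _; rewrite subr_ge0 floor_le.
have Sled : S <= d%:R.
  rewrite S_E -sd -sum1_card natr_sum; apply: ler_sum => i _.
  by rewrite lerBlDl; have := floorD1_gt (lam i 0); rewrite intrD addrC => /ltW.
have lt_k : k * (1 + rho) * S < k * (2 * d + 2)%:R.
  rewrite -mulrA ltr_pM2l // natrD natrM.
  have : rho * S <= rho * d%:R by rewrite ler_pM2l.
  have := ler0n R d; nra.
have h_ge0 j : inCone R A s (colR R A j) -> 0 <= h (colR R A j).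
  by move=> /(inCone_coordP A s _ sd si) hj; apply: sumr_ge0.
pose G (x : 'cV[int]_n) := [/\ GRfeas A s b x, forall i, i \in s -> x i 0 = fl i &
  forall j, j \notin s -> x j 0 != 0 -> inCone R A s (colR R A j)].
have height_eq x : A *m x = b ->
    \sum_(j | j \notin s) (x j 0)%:~R * h (colR R A j) =
    S + \sum_(i in s) (fl i - x i 0)%:~R.
  move=> xb; have := height_rep A s x sd si; rewrite xb -/h => e.
  have -> : \sum_(i in s) (fl i - x i 0)%:~R =
      \sum_(i in s) (fl i)%:~R - \sum_(i in s) (x i 0)%:~R :> R.
    by rewrite -sumrB; apply: eq_bigr => i _; rewrite intrB.
  by rewrite /S e; ring.
have G_S x : G x -> \sum_(j | j \notin s) (x j 0)%:~R * h (colR R A j) = S.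
  case=> [[xb _] xs _]; rewrite height_eq // big1 ?addr0 // => i is'.
  by rewrite xs // subrr.
(* The terms of the sum in [G_S] are nonnegative and add up to [S <= d], so by [HB] no entry reaches
   [B]. *)
have G_bnd x j : G x -> j \notin s -> 0 <= x j 0 < B%:Z.
  move=> Gx js; have := G_S x Gx; case: Gx => [[xb x0] xs xH].
  rewrite x0 //=; have [->|xj] := eqVneq (x j 0) 0; first by rewrite ltz_nat.
  have hj := h_ge0 j (xH _ js xj).
  rewrite (bigD1 j) //= => e.
  have : (x j 0)%:~R * h (colR R A j) <= S.
    rewrite -e lerDl sumr_ge0 // => i /andP[is' _].
    have [->|xi] := eqVneq (x i 0) 0; first by rewrite mul0r.
    by rewrite mulr_ge0 ?ler0z ?x0 // h_ge0 //; apply: xH.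
  move=> /le_trans/(_ Sled)/le_lt_trans/(_ (HB j js (xH _ js xj))).
  have [-> |hj0] := eqVneq (h (colR R A j)) 0; first by rewrite !mulr0 ltxx.
  by rewrite ltr_pM2r ?lt0r ?hj0 // -[B%:R]/((B%:Z)%:~R) ltr_int.
have G_obj x : G x -> GRobj R A c s x <= k * (1 + rho) * S.
  move=> Gx; rewrite -(G_S x Gx) mulr_sumr; case: Gx => [[xb x0] xs xH].
  apply: ler_sum => j js; have [->|xj] := eqVneq (x j 0) 0.
    by rewrite mulr0 mul0r mulr0.
  rewrite mulrC mulrCA ler_wpM2l ?ler0z ?x0 //.
  by case/andP: (Hin j js (xH j js xj)).
have nG_obj x : GRfeas A s b x -> ~ G x -> k * (1 + rho) * S < GRobj R A c s x.
  move=> fx nGx; have [xb x0] := fx.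
  have term0 j : j \notin s -> 0 <= ctilde R A c s 0 j * (x j 0)%:~R.
    by move=> js; rewrite mulr_ge0 ?ler0z ?x0 // ltW // ct0.
  have [[j [js xj nj]]|nout] := pselect (exists j,
      [/\ j \notin s, x j 0 != 0 & ~ inCone R A s (colR R A j)]).
    (* One unit of a column outside the cone already costs [k (2d + 2)], which exceeds
       [k (1 + rho) S] because [S <= d] and [rho <= 1/2]. *)
    apply: lt_le_trans lt_k _; apply: le_trans (Hout j js nj) _.
    rewrite /GRobj (bigD1 j) //=; apply: ler_wpDr.
      by apply: sumr_ge0 => i /andP[/term0].
    apply: ler_peMr; first exact: ltW (ct0 j js).
    by rewrite ler1z -gtz0_ge1 lt0r xj x0.
  have xH j : j \notin s -> x j 0 != 0 -> inCone R A s (colR R A j).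
    by move=> js xj; apply: contrapT => nj; apply: nout; exists j.
  have x_le i : i \in s -> x i 0 <= fl i.
    move=> is'; rewrite /fl floor_ge_int // /lam -xb coord_rep // is'.
    rewrite lerDl; apply: sumr_ge0 => j js.
    have [->|xj] := eqVneq (x j 0) 0; first by rewrite mul0r.
    by rewrite mulr_ge0 ?ler0z ?x0 //; apply: (inCone_coordP A s _ sd si).1; apply: xH.
  have [i is' xi] : exists2 i, i \in s & x i 0 != fl i.
    apply: contrapT => nex; apply: nGx; split=> // i is'.
    by apply: contrapT => /eqP xi; apply: nex; exists i.
  (* An integer deficit at some [i] in [s] has to be made up by the columns outside [s], which adds
     at least 1 to their total height. *)
  have hx : S + 1 <= \sum_(j | j \notin s) (x j 0)%:~R * h (colR R A j).
    rewrite height_eq // lerD2l (bigD1 i) //=; apply: ler_wpDr.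
      by apply: sumr_ge0 => i' /andP[is'' _]; rewrite ler0z subr_ge0 x_le.
    by rewrite ler1z -gtz0_ge1 subr_gt0 lt_neqAle xi x_le.
  (* The inequality amounts to [rho (2 S + 1) < 1]; it follows from [S <= d] and
     [rho (2d + 2) = 1]. *)
  apply: (@lt_le_trans _ _ (k * (1 - rho) * (S + 1))).
    rewrite -!mulrA ltr_pM2l //.
    have : rho * S <= rho * d%:R by rewrite ler_pM2l.
    nra.
  have k1 : 0 <= k * (1 - rho).
    by rewrite mulr_ge0 ?(ltW k0) //; have := ler0n R d; nra.
  apply: le_trans (ler_wpM2l k1 hx) _; rewrite mulr_sumr; apply: ler_sum => j js.
  have [->|xj] := eqVneq (x j 0) 0; first by rewrite mulr0 mul0r mulr0.
  rewrite mulrCA mulrC ler_wpM2r ?ler0z ?x0 //.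
  by case/andP: (Hin j js (xH j js xj)).
(* [y] carries the integer parts. The coordinates of [b - A *m y] are the fractional parts, so it
   lies in the cone and normality expresses it by columns in the cone. *)
have [x0 Gx0] : exists x, G x.
  pose y : 'cV[int]_n := \col_i (if i \in s then fl i else 0).
  have lamr : L *m map_mx (fun z : int => z%:~R) (b - A *m y) =
      \col_i (if i \in s then lam i 0 - (fl i)%:~R else 0).
    apply/colP => i; rewrite map_mxB mulmxBr [LHS]mxE [X in _ + X]mxE coord_rep // [RHS]mxE.
    rewrite [X in _ - (_ + X)]big1 ?addr0; last first.
      by move=> j /negPf js; rewrite [y _ _]mxE js mul0r.
    case: ifPn => is'; first by rewrite [y _ _]mxE is'.
    by rewrite coord_supp // subr0.
  have [|m [mH rE]] := normal (b - A *m y).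
    apply/inCone_coordP => // i; rewrite lamr mxE; case: ifP => // _.
    by rewrite subr_ge0 floor_le.
  pose mm : 'cV[int]_n := \col_j (m j)%:Z.
  have mmE : A *m mm = b - A *m y.
    rewrite rE; apply/colP => i; rewrite mxE summxE; apply: eq_bigr => j _.
    by rewrite !mxE mulrC.
  (* A column of [s] used once would give a coordinate of at least 1, but fractional parts are below
     1. *)
  have ms j : j \in s -> m j = 0%N.
    move=> js; have := congr1 (fun M : 'cV_n => M j 0) lamr.
    rewrite -mmE coord_rep // [RHS]mxE js mxE => e.
    have : 0 <= \sum_(i | i \notin s)
        (mm i 0)%:~R * (coordmx R A s *m colR R A i) j 0.
      apply: sumr_ge0 => i is'; rewrite mxE.
      have [->|mi] := eqVneq (m i) 0%N; first by rewrite mul0r.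
      by rewrite mulr_ge0 ?ler0z //; apply: (inCone_coordP A s _ sd si).1; apply: mH.
    move=> sum0; apply/eqP; rewrite -leqn0 -ltnS -ltz_nat -(ltr_int R).
    have := floorD1_gt (lam j 0); rewrite intrD -/(fl j).
    have : (m j)%:Z%:~R <= lam j 0 - (fl j)%:~R by rewrite -e lerDl.
    by move=> e1 e2; apply: le_lt_trans e1 _; rewrite ltrBlDl.
  exists (y + mm); split.
  - split; first by rewrite mulmxDr mmE addrC subrK.
    by move=> j /negPf js; rewrite !mxE js add0r.
  - by move=> i is'; rewrite !mxE is' ms // addr0.
  - by move=> j /negPf js; rewrite !mxE js add0r; apply: mH.
(* Points of [G] have prescribed entries on [s] and entries below [B] elsewhere, so finite functions
   encode them and a minimum exists. *)
pose xf (f : {ffun 'I_n -> 'I_B.+1}) : 'cV[int]_n :=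
  \col_j (if j \in s then fl j else (f j : nat)%:Z).
have xfP x : G x -> exists f, xf f = x.
  move=> Gx; exists [ffun j => inord (absz (x j 0))]; apply/colP => j; rewrite mxE ffunE.
  case: ifPn => js; first by case: Gx => _ ->.
  have := G_bnd x j Gx js => /andP[xj0 xjB].
  by rewrite inordK ?gez0_abs //; lia.
have [f0 f0E] := xfP x0 Gx0.
have Pf0 : `[< G (xf f0) >] by apply/asboolP; rewrite f0E.
case: (@arg_minP _ _ _ f0 (fun f => `[< G (xf f) >])
  (fun f => GRobj R A c s (xf f)) Pf0) => f /asboolP Gf fmin.
have [[fb fpos] fs _] := Gf.
exists (xf f); split=> // [j|x' fx' x'x].
  by case: (boolP (j \in s)) => [/fs -> //|/fpos].
have [Gx'|nGx'] := pselect (G x'); last first.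
  exact: le_lt_trans (G_obj _ Gf) (nG_obj x' fx' nGx').
have [f' f'E] := xfP x' Gx'; rewrite -f'E in Gx' fx' x'x *.
rewrite lt_neqAle fmin ?andbT; last exact/asboolP.
apply/eqP => e; apply: x'x; apply: sep.
- by move=> i is'; rewrite fs //; case: Gx' => _ ->.
- by move=> j; apply: G_bnd.
- by move=> j; apply: G_bnd.
move: e; rewrite !GRobj_cost //; case: fx' => -> _; rewrite fb.
by move=> /addIr.
Qed.

(** * A real cost that charges heights *)

Lemma ctilde_lin {R : realType} {d n : nat} (A : 'M[int]_(d, n)) (s : {set 'I_n})
  (a : R) (c c' : 'rV[R]_n) j :
  ctilde R A (a *: c + c') s 0 j = a * ctilde R A c s 0 j + ctilde R A c' s 0 j.
Proof.
have csigD : csig R d (a *: c + c') s = a *: csig R d c s + csig R d c' s.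
  rewrite /csig; have [e|ne] := eqVneq #|s| d.
    case: _ / e {A}; rewrite !conform_mx_id.
    by apply/rowP => i; rewrite !mxE.
  (* For [#|s|] different from [d], [csig] takes the default value 0, which is linear as well. *)
  by rewrite !nonconform_mx ?ne ?orbT // scaler0 addr0.
have -> : ctilde R A (a *: c + c') s = a *: ctilde R A c s + ctilde R A c' s.
  rewrite /ctilde csigD !mulmxDl -!scalemxAl scalerBr.
  by rewrite opprD addrACA.
by rewrite 2!mxE.
Qed.

Lemma colR_neq0 {R : realType} {d n : nat} (A : 'M[int]_(d, n)) j :
  (forall x : 'cV[R]_n, (forall j, 0 <= x j 0) -> AR R A *m x = 0 -> x = 0) ->
  colR R A j != 0.
Proof.
move=> Hb; apply/eqP; rewrite colRE => /Hb h.
have /h : forall i, 0 <= (delta_mx j 0 : 'cV[R]_n) i 0 by move=> i; rewrite mxE.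
by move=> /colP/(_ j)/eqP; rewrite !mxE !eqxx oner_eq0.
Qed.

Lemma height_gt0 {R : realType} {d n : nat} (A : 'M[int]_(d, n)) (s : {set 'I_n})
  (z : 'cV[R]_d) : #|s| = d -> lin_indep R A s -> inCone R A s z -> z != 0 ->
  0 < height R A s z.
Proof.
move=> sd si /(inCone_coordP A s _ sd si) h z0; rewrite lt0r sumr_ge0 // andbT.
apply: contraNneq z0 => /eqP; rewrite psumr_eq0 // => /allP h0.
rewrite -(coordK A s _ z sd si) [_ *m z](_ : _ = 0) ?mulmx0 //.
by apply/colP => i; rewrite [RHS]mxE; apply/eqP; apply: h0; rewrite mem_index_enum.
Qed.

Lemma full_cover {R : realType} {d n : nat} (A : 'M[int]_(d, n)) D (c' : 'rV[R]_n) z :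
  \rank (AR R A) = d -> triangulation R A D -> (forall s, D s <-> Delta R A c' s) ->
  coneA R A z -> exists s : {set 'I_n}, [/\ D s, #|s| = d & inCone R A s z].
Proof.
move=> Ar [_ Di Dcov _] Dc /Dcov[s [Ds zs]].
have [|t [st Dt td]] := Delta_full_face A s c' Ar _ ((Dc s).1 Ds).
  by move=> t /Dc; apply: Di.
by exists t; split=> //; [apply/Dc|apply: inCone_subset st zs].
Qed.

Lemma inCone_col {R : realType} {d n : nat} (A : 'M[int]_(d, n)) (s : {set 'I_n}) j :
  j \in s -> inCone R A s (colR R A j).
Proof.
move=> js; apply/inConeP; exists (delta_mx j 0); split=> [i|i is'|].
- by rewrite mxE; case: andP.
- rewrite mxE; case: eqP => // ij; by rewrite ij js in is'.
- exact: colRE.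
Qed.

(* The cost is [P c0 + w], where [c0] is the piecewise linear function on the
   fan with the values of [c'] on the rays, evaluated at all columns, and [w]
   charges every column that is not a ray its height. *)
Lemma height_cost {R : realType} {d n : nat} (A : 'M[int]_(d, n)) D (c' : 'rV[R]_n)
  (K : R) : \rank (AR R A) = d -> triangulation R A D ->
  (forall s, D s <-> Delta R A c' s) ->
  exists c : 'rV[R]_n, forall s : {set 'I_n}, D s -> #|s| = d -> forall j, j \notin s ->
    (inCone R A s (colR R A j) -> ctilde R A c s 0 j = height R A s (colR R A j)) /\
    (~ inCone R A s (colR R A j) -> K < ctilde R A c s 0 j).
Proof.
move=> Ar tri Dc; have [_ Di _ _] := tri.
have cover j : exists s : {set 'I_n}, [/\ D s, #|s| = d & inCone R A s (colR R A j)].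
  apply: (full_cover _ _ c') => //.
  by apply: inCone_col; rewrite inE.
have [tau htau] := fin_all_exists cover.
(* Column [j] of [U] holds the coordinates of column [j] of [A] in a chosen maximal cone [tau j]. By
   [coord_eq] the choice is immaterial, so [c' *m U] is the interpolation of [c']. *)
pose U : 'M[R]_n := \matrix_(i, j) (coordmx R A (tau j) *m colR R A j) i 0.
have UE i j : U i j = (coordmx R A (tau j) *m colR R A j) i 0 by rewrite [LHS]mxE.
have U0 i j : 0 <= U i j.
  rewrite UE; have [Dt td jt] := htau j.
  exact: ((inCone_coordP A _ _ td (Di _ Dt)).1 jt).
have Ucone s j i : D s -> #|s| = d -> inCone R A s (colR R A j) ->
    U i j = (coordmx R A s *m colR R A j) i 0.
  by move=> Ds sd js; rewrite UE; have [Dt td jt] := htau j; rewrite (coord_eq A D s (tau j)).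
have Ucol s i j : D s -> #|s| = d -> j \in s -> U i j = (i == j)%:R.
  move=> Ds sd js; rewrite (Ucone s) //; last exact: inCone_col.
  by have [_ _ -> //] := coordmx_spec A s sd (Di s Ds); rewrite mxE eqxx andbT.
have AU : AR R A *m U = AR R A.
  apply/matrixP => i j; have [Dt td jt] := htau j.
  have := congr1 (fun M : 'cV_d => M i 0) (coordK A (tau j) _ (colR R A j) td (Di _ Dt)).
  rewrite [RHS]mxE => <-; rewrite [LHS]mxE [RHS]mxE.
  by apply: eq_bigr => k _; rewrite UE.
(* Hence [j \in tau j] tests whether column [j] belongs to any maximal face. *)
have tau_in s j : D s -> #|s| = d -> j \in s -> j \in tau j.
  move=> Ds sd js; apply: contraT => jt; have := Ucol s j j Ds sd js.
  have [Dt td _] := htau j.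
  by rewrite UE coord_supp ?eqxx //; [move/esym/eqP; rewrite oner_eq0|apply: Di].
pose w : 'rV[R]_n := \row_j (if j \in tau j then 0 else \sum_i U i j).
have ctw s j : D s -> #|s| = d -> ctilde R A w s 0 j = w 0 j.
  move=> Ds sd; rewrite ctildeE ?Di // [w *m _](_ : _ = 0) ?mul0mx ?subr0 //.
  have [_ hL _ _] := coordmx_spec A s sd (Di s Ds).
  apply/rowP => k; rewrite [LHS]mxE [RHS]mxE big1 // => i _.
  case: (boolP (i \in s)) => is'; first by rewrite [w _ _]mxE (tau_in s) // mul0r.
  have := congr1 (fun M : 'rV_d => M 0 k) (hL i is'); rewrite !mxE => ->.
  by rewrite mulr0.
pose c0 := c' *m U.
(* Reduction at [s] commutes with interpolation, because [AU] holds and [U] fixes vectors supported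
   on [s]. *)
have ctc0 s j : D s -> #|s| = d ->
    ctilde R A c0 s 0 j = \sum_i ctilde R A c' s 0 i * U i j.
  move=> Ds sd; have [_ hL _ _] := coordmx_spec A s sd (Di s Ds).
  have UL : U *m coordmx R A s = coordmx R A s.
    apply/matrixP => i k; rewrite [LHS]mxE (bigID [in s]) /= [X in _ + X]big1 ?addr0.
      case: (boolP (i \in s)) => is'.
        rewrite (bigD1 i) //= (Ucol s) // eqxx mul1r big1 ?addr0 // => l /andP[ls li].
        by rewrite (Ucol s) // eq_sym (negPf li) mul0r.
      have := congr1 (fun M : 'rV_d => M 0 k) (hL i is'); rewrite !mxE => ->.
      rewrite big1 // => l ls; rewrite (Ucol s) //.
      by case: eqP => [il|]; [rewrite -il (negPf is') in ls|rewrite mul0r].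
    move=> l ls; have := congr1 (fun M : 'rV_d => M 0 k) (hL l ls).
    by rewrite !mxE => ->; rewrite mulr0.
  rewrite !ctildeE ?Di //.
  transitivity (((c' - c' *m coordmx R A s *m AR R A) *m U) 0 j); last by rewrite mxE.
  by congr (_ 0 j); rewrite mulmxBl /c0 -(mulmxA c' U) UL -(mulmxA _ (AR R A)) AU.
have ctc'0 s i : D s -> #|s| = d -> 0 <= ctilde R A c' s 0 i.
  move=> Ds sd; case: (boolP (i \in s)) => is'; first by rewrite ctilde_in ?Di.
  by apply: ltW; apply: (DeltaP A s c' sd (Di s Ds)).1 => //; apply/Dc.
have ctc0_gt0 s j : D s -> #|s| = d -> ~ inCone R A s (colR R A j) ->
    0 < ctilde R A c0 s 0 j.
  move=> Ds sd js; rewrite ctc0 // lt0r sumr_ge0 ?andbT; last first.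
    by move=> i _; rewrite mulr_ge0 ?ctc'0.
  (* If the sum vanished, the coordinates in column [j] of [U] would be supported where [ctilde] of
     [c'] is zero, that is on [s], and column [j] would lie in the cone of [s]. *)
  apply/negP; rewrite psumr_eq0 => [/allP h0|i _]; last by rewrite mulr_ge0 ?ctc'0.
  apply: js; apply/inConeP; exists (col j U); split=> [i|i is'|].
  - by rewrite mxE.
  - have cti : 0 < ctilde R A c' s 0 i.
      by apply: (DeltaP A s c' sd (Di s Ds)).1 => //; apply/Dc.
    have /implyP/(_ isT) := h0 i (mem_index_enum i).
    by rewrite [col _ _ _ _]mxE mulf_eq0 (gt_eqF cti) => /eqP.
  - by rewrite colE mulmxA AU colRE.
have [P hP] : exists P0, forall P, (P0 <= P)%N -> forall sj : {set 'I_n} * 'I_n,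
    D sj.1 -> #|sj.1| = d -> ~ inCone R A sj.1 (colR R A sj.2) ->
    K < P%:R * ctilde R A c0 sj.1 0 sj.2.
  apply: finite_eventually => -[s j] /=.
  have [[[Ds sd] js]|nh] := pselect ((D s /\ #|s| = d) /\ ~ inCone R A s (colR R A j)).
    have [P0 h] := eventually_lt_mul _ K (ctc0_gt0 s j Ds sd js).
    by exists P0 => P /h.
  by exists 0%N => P _ Ds sd js; case: nh.
exists (P%:R *: c0 + w) => s Ds sd j js; rewrite ctilde_lin ctw //.
split=> jc; last first.
  apply: lt_le_trans (hP P (leqnn P) (s, j) Ds sd jc) _; rewrite lerDl mxE.
  by case: ifP => // _; apply: sumr_ge0.
have -> : ctilde R A c0 s 0 j = 0.
  rewrite ctc0 // big1 // => i _; case: (boolP (i \in s)) => is'.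
    by rewrite ctilde_in ?mul0r ?Di.
  by rewrite (Ucone s) // coord_supp ?mulr0 //; apply: Di.
rewrite mulr0 add0r mxE ifN; first by apply: eq_bigr => i _; apply: Ucone.
(* Otherwise the coordinate of column [j] at index [j] would be 1 in [tau j] and 0 in [s], as [j] is
   outside [s]. *)
apply/negP => jt; have [Dt td _] := htau j.
have := Ucol (tau j) j j Dt td jt; rewrite (Ucone s) // coord_supp ?Di // eqxx.
by move/esym/eqP; rewrite oner_eq0.
Qed.

(** * Rounding to an integer cost *)

(* All entries are congruent to distinct powers of [B] modulo [B ^ n], so equal
   costs force equal base-[B] digits. *)
Definition digit_cost {R : realType} {n : nat} (c : 'rV[R]_n) (B N : nat) : 'rV[int]_n :=
  \row_j (B%:Z ^+ n * Num.floor (N%:R * c 0 j) + B%:Z ^+ j).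

Lemma digit_cost_inj {R : realType} {n : nat} (c : 'rV[R]_n) (B N : nat)
  (s : {set 'I_n}) (x x' : 'cV[int]_n) :
  (0 < B)%N -> (forall i, i \in s -> x i 0 = x' i 0) ->
  (forall j, j \notin s -> 0 <= x j 0 < B%:Z) ->
  (forall j, j \notin s -> 0 <= x' j 0 < B%:Z) ->
  let cR := map_mx (fun k : int => k%:~R : R) (digit_cost c B N) in
  cost R cR x = cost R cR x' -> x = x'.
Proof.
move=> B0 xs xB xB' /= /eqP.
have costE y : cost R (map_mx (fun k : int => k%:~R : R) (digit_cost c B N)) y =
    (\sum_j digit_cost c B N 0 j * y j 0)%:~R.
  rewrite /cost rmorph_sum; apply: eq_bigr => j _.
  by rewrite [map_mx _ _ _ _]mxE rmorphM.
rewrite !costE eqr_int -subr_eq0 -sumrB => /eqP e.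
have h := digits_eq0 n B (fun j => x j 0 - x' j 0).
apply/colP => j; apply/eqP; rewrite -subr_eq0; apply/eqP; apply: h => [i|].
  case: (boolP (i \in s)) => is'; first by rewrite xs // subrr normr0 ltz_nat.
  have := xB i is'; have := xB' i is'; lia.
have -> : \sum_(j < n) B%:Z ^+ j * (x j 0 - x' j 0) = - (B%:Z ^+ n *
    \sum_(j < n) Num.floor (N%:R * c 0 j) * (x j 0 - x' j 0)).
  apply/eqP; rewrite -subr_eq0 opprK; apply/eqP; rewrite -[RHS]e mulr_sumr -big_split /=.
  by apply: eq_bigr => i _; rewrite [digit_cost _ _ _ _ _]mxE; ring.
by rewrite rpredN dvdz_mulr.
Qed.

(** Reduced costs are linear in the cost. The floor errs by less than [B ^ n] downwards and the
    digit adds at most [B ^ n], so each entry is off by at most [B ^ n], independently of [N], while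
    the tolerance grows with [N]. *)
Lemma ctilde_digit_cost {R : realType} {d n : nat} (A : 'M[int]_(d, n))
  (s : {set 'I_n}) (c : 'rV[R]_n) (B : nat) j (e : R) :
  #|s| = d -> lin_indep R A s -> (0 < B)%N -> 0 < e ->
  exists N0, forall N, (N0 <= N)%N ->
  `|ctilde R A (map_mx (fun k : int => k%:~R : R) (digit_cost c B N)) s 0 j -
    (B ^ n * N)%:R * ctilde R A c s 0 j| <= (B ^ n * N)%:R * e.
Proof.
move=> sd si B0 e0.
pose M : 'M[R]_n := 1%:M - coordmx R A s *m AR R A.
have ctM (v : 'rV[R]_n) : ctilde R A v s 0 j = \sum_i v 0 i * M i j.
  transitivity ((v *m M) 0 j); last by rewrite mxE.
  by rewrite ctildeE // -mulmxA /M mulmxBr mulmx1.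
have [N0 hN] := eventually_lt_mul e (\sum_i `|M i j|) e0.
exists N0 => N /hN {}hN.
set cR := map_mx _ _.
have -> : ctilde R A cR s 0 j - (B ^ n * N)%:R * ctilde R A c s 0 j =
    ctilde R A (cR - (B ^ n * N)%:R *: c) s 0 j.
  by rewrite [cR - _]addrC -scaleNr ctilde_lin mulNr addrC.
rewrite ctM; apply: le_trans (ler_norm_sum _ _ _) _.
rewrite natrM -mulrA; apply: le_trans (_ : (B ^ n)%:R * \sum_i `|M i j| <= _); last first.
  by rewrite ler_wpM2l // ltW.
rewrite mulr_sumr; apply: ler_sum => i _; rewrite normrM ler_wpM2r //.
have -> : (cR - ((B ^ n)%:R * N%:R) *: c) 0 i =
    (B ^ n)%:R * ((Num.floor (N%:R * c 0 i))%:~R - N%:R * c 0 i) + (B ^ i)%:R.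
  have cRi : cR 0 i = (B ^ n)%:R * (Num.floor (N%:R * c 0 i))%:~R + (B ^ i)%:R.
    by rewrite [LHS]mxE [digit_cost _ _ _ _ _]mxE intrD intrM !rmorphXn.
  have -> : (cR - ((B ^ n)%:R * N%:R) *: c) 0 i =
      cR 0 i - (B ^ n)%:R * N%:R * c 0 i.
    by rewrite [LHS]mxE [X in _ + X]mxE [X in - X]mxE.
  by rewrite cRi; ring.
have := floor_le (N%:R * c 0 i); have := floorD1_gt (N%:R * c 0 i); rewrite intrD.
have Bi : (B ^ i)%:R <= (B ^ n)%:R :> R by rewrite ler_nat leq_pexp2l // ltnW.
have Bi0 : 0 <= (B ^ i)%:R :> R by [].
have Bn0 : 0 <= (B ^ n)%:R :> R by [].
rewrite mulr1z; set f := (Num.floor _)%:~R; set g := N%:R * _ => gf fg.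
have q1 : (B ^ n)%:R * (f - g) <= 0 by rewrite mulr_ge0_le0 // subr_le0.
have q2 : 0 <= (B ^ n)%:R * (f - g + 1) by rewrite mulr_ge0 //; lra.
rewrite mulrDr mulr1 in q2.
by rewrite ler_norml; apply/andP; split; lra.
Qed.

(** * Genericity, the Gomory property and the conclusion *)

(** Feasible points of the program are feasible for the relaxation, where cost and objective differ
    by a constant. A nonnegative strict optimum of the relaxation is thus the unique optimum of the
    program. *)
Lemma generic_Gomory {R : realType} {d n : nat} (A : 'M[int]_(d, n)) (c : 'rV[R]_n) :
  triangulation R A (Delta R A c) ->
  (forall b, inNA A b -> exists s, [/\ maxface (Delta R A c) s, #|s| = d &
    exists x : 'cV[int]_n, [/\ forall j, 0 <= x j 0, GRfeas A s b x &
      forall x', GRfeas A s b x' -> x' <> x -> GRobj R A c s x < GRobj R A c s x']]) ->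
  generic R A c /\ Gomory R A c.
Proof.
move=> tri key; have [_ Di _ _] := tri; split; last first.
  move=> b /key[s [ms _ [x [x0 fx xmin]]]]; exists s; split=> //; exists x; split=> //.
  split=> // x' fx'; have [->//|x'x] := pselect (x' = x).
  by apply: ltW; apply: xmin.
split=> // b /key[s [[Ds _] sd [x [x0 fx xmin]]]].
have costlt x' : IPfeas A b x' -> x' <> x -> cost R c x < cost R c x'.
  move=> [x'0 x'b] x'x; have /xmin/(_ x'x) : GRfeas A s b x' by split.
  by rewrite !GRobj_cost ?Di // x'b (fx.1) ltrD2r.
exists x; split.
  split; first by split=> //; case: fx.
  by move=> x' fx'; have [->//|/(costlt x' fx')/ltW] := pselect (x' = x).
move=> x' [fx' min']; apply: contrapT => /nesym /(costlt x' fx').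
by rewrite ltNge min' //; split=> //; case: fx.
Qed.

Theorem theorem4p7 (R : realType) (d n : nat) (A : 'M[int]_(d, n))
  (Hrank : \rank (AR R A) = d)
  (Hpointed : forall z : 'cV[R]_d, coneA R A z -> coneA R A (- z) -> z = 0)
  (Hbounded : forall x : 'cV[R]_n, (forall j, 0 <= x j 0) -> AR R A *m x = 0 -> x = 0)
  (Hlattice : forall z : 'cV[int]_d, exists u : 'cV[int]_n, z = A *m u)
  (D : {set 'I_n} -> Prop)
  (Hreg : regular_triangulation R A D)
  (Hnormal : Delta_normal R A D) :
  exists c : 'rV[int]_n,
    let cR := map_mx (fun k : int => (k%:~R : R)) c in
    generic R A cR /\ (forall s, D s <-> Delta R A cR s) /\ Gomory R A cR.
Proof.
have [tri [c' Dc']] := Hreg; have [_ Di _ _] := tri.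
pose K : R := (2 * d + 2)%:R.
have K0 : 0 < K by rewrite ltr0n addn2.
have [c1 hc1] := height_cost A D c' K Hrank tri Dc'.
pose ell (s : {set 'I_n}) j := height R A s (colR R A j).
have ell0 s j : D s -> #|s| = d -> inCone R A s (colR R A j) -> 0 < ell s j.
  move=> Ds sd js; apply: height_gt0 => //; first exact: Di.
  exact: colR_neq0.
have [B1 hB1] : exists B0, forall B, (B0 <= B)%N -> forall sj : {set 'I_n} * 'I_n,
    D sj.1 -> #|sj.1| = d -> inCone R A sj.1 (colR R A sj.2) ->
    d%:R < B%:R * ell sj.1 sj.2.
  apply: finite_eventually => -[s j] /=.
  have [[[Ds sd] js]|nh] := pselect ((D s /\ #|s| = d) /\ inCone R A s (colR R A j)).
    have [N0 h] := eventually_lt_mul _ d%:R (ell0 s j Ds sd js).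
    by exists N0 => N /h.
  by exists 0%N => N _ Ds sd js; case: nh.
(* [B] depends only on the heights and is fixed before [N], whose threshold depends on [B]. *)
pose B := B1.+1; have B0 : (0 < B)%N by [].
pose cR N : 'rV[R]_n := map_mx (fun k : int => (k%:~R : R)) (digit_cost c1 B N).
have [N0 hN] : exists N0, forall N, (N0 <= N)%N -> forall sj : {set 'I_n} * 'I_n,
    D sj.1 -> #|sj.1| = d -> sj.2 \notin sj.1 ->
    let ct := ctilde R A (cR N) sj.1 0 sj.2 in
    let k := (B ^ n * N)%:R in
    (inCone R A sj.1 (colR R A sj.2) ->
      k * (1 - K^-1) * ell sj.1 sj.2 <= ct <= k * (1 + K^-1) * ell sj.1 sj.2) /\
    (~ inCone R A sj.1 (colR R A sj.2) -> k * K <= ct).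
  apply: finite_eventually => -[s j] /=.
  have [[[Ds sd] js]|nh] := pselect ((D s /\ #|s| = d) /\ j \notin s); last first.
    by exists 0%N => N _ Ds sd js; case: nh.
  have [hin hout] := hc1 s Ds sd j js.
  have [jc|jc] := pselect (inCone R A s (colR R A j)).
    (* The tolerance is the relative error [1 / K] allowed by [group_relaxation_opt]; for columns
       outside the cone it is the excess of the reduced cost over [K]. *)
    have e0 : 0 < K^-1 * ell s j by rewrite mulr_gt0 ?invr_gt0 ?ell0.
    have [N0 h] := ctilde_digit_cost A s c1 B j _ sd (Di s Ds) B0 e0.
    exists N0 => N /h + _ _ _; rewrite hin // -/(ell s j) -/(cR N) ler_norml.
    move: (K^-1) => q /andP[h1 h2]; split=> // _.
    by apply/andP; split; lra.
  have e0 : 0 < ctilde R A c1 s 0 j - K by rewrite subr_gt0 hout.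
  have [N0 h] := ctilde_digit_cost A s c1 B j _ sd (Di s Ds) B0 e0.
  exists N0 => N /h + _ _ _; rewrite -/(cR N) ler_norml mulrBr.
  by move=> /andP[h1 h2]; split=> // _; lra.
pose N := N0.+1; have {}hN := hN N (leqnSn N0).
set k : R := (B ^ n * N)%:R in hN.
have k0 : 0 < k by rewrite ltr0n muln_gt0 expn_gt0.
have ct0 s j : D s -> #|s| = d -> j \notin s -> 0 < ctilde R A (cR N) s 0 j.
  move=> Ds sd js; have [hin hout] := hN (s, j) Ds sd js.
  have [jc|jc] := pselect (inCone R A s (colR R A j)).
    have /andP[+ _] := hin jc; apply: lt_le_trans.
    rewrite !mulr_gt0 ?ell0 // subr_gt0 invf_lt1 // ltr1n addn2; lia.
  by apply: lt_le_trans (hout jc); rewrite mulr_gt0.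
(* Positive reduced costs certify only the faces with [d] elements; every other face is obtained as
   a subset of one of these. *)
have Dsub s : D s -> Delta R A (cR N) s.
  move=> /Dc' Ds.
  have [|t [st Dt td]] := Delta_full_face A s c' Hrank _ Ds.
    by move=> t /Dc'; apply: Di.
  have {}Dt : D t by apply/Dc'.
  apply: (Delta_face A t) => //; first exact: Di.
  by apply/DeltaP => // [|j jt]; [apply: Di|apply: ct0].
have Deq := Delta_eq A D (cR N) tri Dsub.
have DE : Delta R A (cR N) = D.
  by apply/funext => s; apply/propext; rewrite Deq.
exists (digit_cost c1 B N) => /=; rewrite -/(cR N).
suff [gen gom] : generic R A (cR N) /\ Gomory R A (cR N) by [].
apply: generic_Gomory; rewrite DE // => b [u [u0 bE]].
have [|s [Ds sd bs]] := full_cover A D c' (map_mx (fun z : int => z%:~R) b) Hrank tri Dc'.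
  apply/inConeP; exists (map_mx (fun z : int => z%:~R) u); split=> [j|j|].
  - by rewrite mxE ler0z.
  - by rewrite inE.
  - by rewrite bE map_mxM.
have smax := full_maxface A D s Di Ds sd.
exists s; split=> //.
apply: (group_relaxation_opt A s (cR N) k B) => //.
- exact: Di.
- by move=> j js jc; have [h _] := hN (s, j) Ds sd js; apply: h.
- by move=> j js jc; apply: (hB1 B (leqnSn B1) (s, j)).
- by move=> j js jc; have [_ h] := hN (s, j) Ds sd js; apply: h.
- by move=> j; apply: ct0.
- by move=> x x'; apply: digit_cost_inj.
- exact: Hnormal.
Qed.
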